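(* Let $(Y_i: i\in I)$ be a family of compact spaces such that for every finite set $I_0\subseteq I$ the product $\prod_{i\in I_0}Y_i$ is a Kempisty space. Then the product $Y=\prod_{i\in I}Y_i$ is a Kempisty space.
   Context: A topological space is Baire if every countable intersection of dense open subsets is dense. A mapping $g:X\to Z$ between topological spaces is quasi-continuous if for every $x_0\in X$, every neighborhood $U$ of $x_0$ and every neighborhood $V$ of $g(x_0)$ there is a nonempty open in $X$ set $G\subseteq U$ with $g(G)\subseteq V$. A function $f:X\times Y\to\mathbb R$ is quasi-continuous in the first variable if $x\mapsto f(x,y)$ is quasi-continuous for each $y\in Y$, and continuous in the second variable if $y\mapsto f(x,y)$ is continuous for each $x\in X$. A mapping $f:X\times Y\to Z$ has the Namioka property if there exists a dense in $X$ $G_\delta$-set $A\subseteq X$ such that $f$ is jointly continuous at each point of $A\times Y$. A topological space $Y$ is a Kempisty space if for every Baire space $X$ every function $f:X\times Y\to\mathbb R$ which is quasi-continuous in the first variable and continuous in the second variable has the Namioka property. Products carry the product topology. *)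

(* Defs.v *)
From mathcomp Require Import all_boot all_order all_algebra.
From mathcomp Require Import all_classical all_reals all_analysis.
From mathcomp Require Import borel_hierarchy.
Import numFieldNormedType.Exports.

Set Implicit Arguments.
Unset Strict Implicit.
Unset Printing Implicit Defensive.

Local Open Scope classical_set_scope.

Definition baire_space (X : topologicalType) : Prop :=
  forall F : nat -> set X,
    (forall n, open (F n) /\ dense (F n)) -> dense (\bigcap_n F n).

(* The open set [G] is not required to contain [x0]. *)
Definition quasi_continuous (X Z : topologicalType) (g : X -> Z) : Prop :=
  forall (x0 : X) (U : set X) (V : set Z), nbhs x0 U -> nbhs (g x0) V ->
    exists G : set X, [/\ open G, G !=set0, G `<=` U & g @` G `<=` V].

Definition namioka_property (X Y Z : topologicalType) (f : X * Y -> Z) : Prop :=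
  exists A : set X, [/\ dense A, Gdelta A &
    forall p : X * Y, (A `*` [set: Y]) p -> {for p, continuous f}].

Definition kempisty_space (R : realType) (Y : topologicalType) : Prop :=
  forall X : topologicalType, baire_space X ->
  forall f : X * Y -> R,
    (forall y : Y, quasi_continuous (fun x : X => f (x, y))) ->
    (forall x : X, continuous (fun y : Y => f (x, y))) ->
    namioka_property f.

(* Main.v *)
Require Import Defs.
From mathcomp Require Import all_boot all_order all_algebra.
From mathcomp Require Import all_classical all_reals all_analysis.
From mathcomp Require Import borel_hierarchy lra.
Import numFieldNormedType.Exports.
Import Order.TTheory GRing.Theory Num.Theory.
Local Open Scope classical_set_scope.
Local Open Scope ring_scope.

(** Call a function on the product [e]-determined by a set [J] of coordinates
    if changing its argument outside [J] moves the value by at most [e].  Fix a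
    base point [a] of the product [Y].

    By compactness each section [f (x, _)] is [e]-determined by finitely many
    coordinates, so [X] is the union of the sets [D n] of those [x] for which
    [n] coordinates suffice ([continuous_depends_on]).  As [X] is Baire, some
    [D n] is dense in a nonempty open subset of any given open set
    ([baire_somewhere_dense]).

    The coordinates depend on [x], and the main step
    ([finite_support_somewhere]) replaces them by one finite set [J] on a
    smaller open set: whenever a finite [J] fails there, it fails because of a
    point [y] that differs from [a] at a finite set [K] of coordinates only, and
    that failure occurs throughout an open set.  On this open set every point of
    [D n] must use a coordinate in [K].  Adding [K] to [J] thus lowers by
    one the number of further coordinates needed, and this cannot be repeated
    more than [n] times.

    Failure has to be understood as failure at all points of an open set, because
    [f (_, y) - f (_, y')] need not be quasi-continuous when both terms are.
    The conclusion is correspondingly weak: for each [y] separately, replacing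
    the coordinates of [y] outside [J] by those of [a] is harmless at densely
    many [x] only, with [y] a finite variant of [a].  It is enough, because
    the function [f] with the coordinates outside [J] frozen is a function on
    [X] times a finite product, which is jointly continuous at the points of a
    dense set by hypothesis; an estimate valid at densely many [x] for
    the frozen function then propagates to [f] at all nearby points by
    quasi-continuity in [x] and continuity in [y] ([oscillation_of_freeze]).
    Finally, small oscillation along [{x} * Y] for densely many [x] yields a dense
    G-delta of points [x] of continuity, by compactness of [Y] and the Baire
    property again ([namioka_of_small_oscillation]). *)

(** * Changing finitely many coordinates *)

Definition agree_on {I : Type} {Y : I -> Type} (J : set I)
  (y z : forall i, Y i) : Prop := forall i, J i -> y i = z i.

Lemma agree_onW {I : Type} {Y : I -> Type} (J K : set I)
  (y z : forall i, Y i) : J `<=` K -> agree_on K y z -> agree_on J y z.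
Proof. by move=> JK Kyz i /JK; exact: Kyz. Qed.

Definition extend {I : Type} {Y : I -> Type} (J : set I)
    (a : forall i, Y i) (z : forall j : J, Y (val j)) (i : I) : Y i :=
  match pselect (J i) with
  | left Ji => z (exist _ i (mem_set Ji))
  | right _ => a i
  end.

(** Factoring through [extend] turns the frozen function into a function on the
    product over [J] alone. *)
Definition freeze {I : Type} {Y : I -> Type} (J : set I)
    (a y : forall i, Y i) : forall i, Y i :=
  extend J a (fun j => y (val j)).

Lemma freeze_agree {I : Type} {Y : I -> Type} (J : set I)
  (a y : forall i, Y i) : agree_on J (freeze J a y) y.
Proof. by move=> i Ji; rewrite /freeze /extend; case: pselect. Qed.

Lemma freeze_agreeC {I : Type} {Y : I -> Type} (J : set I)
  (a y : forall i, Y i) : agree_on (~` J) (freeze J a y) a.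
Proof. by move=> i Ji; rewrite /freeze /extend; case: pselect. Qed.

Definition finite_variant {I : Type} {Y : I -> Type} (a y : forall i, Y i) :
  Prop := exists2 K : set I, finite_set K & agree_on (~` K) y a.

Definition depends_on {I : Type} {Y : I -> Type} {R : realType} (e : R)
    (J : set I) (g : (forall i, Y i) -> R) : Prop :=
  forall y z, agree_on J y z -> `|g y - g z| <= e.

(** * Topology of products *)

Lemma continuous_to_prod (S : topologicalType) (I : Type)
    (Y : I -> topologicalType) (g : S -> prod_topology Y) :
  (forall i, continuous (fun s => g s i)) -> continuous g.
Proof.
move=> gc s.
have FF : Filter (g @ s) by exact: fmap_filter.
apply/(@cvg_sup _ _ (fun i => Topological.class
  (initial_topology (fun h : (forall i, Y i) => h i))) _ (g s)) => i A.
rewrite nbhsE => -[_ [[C oC <-] Cgs] CA].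
have /(gc i s) : nbhs (g s i) C by exact: open_nbhs_nbhs.
by apply: (@filterS _ (nbhs s)) => t; exact: CA.
Qed.

(** The sets containing a neighborhood of [y] that is a cylinder over finitely
    many coordinates form a filter.  It converges to [y] coordinate by
    coordinate, hence in the product. *)
Lemma prod_nbhs_cylinder (I : Type) (Y : I -> topologicalType)
    (y : prod_topology Y) (U : set (prod_topology Y)) : nbhs y U ->
  exists J B, [/\ finite_set J, nbhs y B, B `<=` U &
    forall u v, B u -> agree_on J u v -> B v].
Proof.
pose cyl := [set A : set (prod_topology Y) | exists J B,
  [/\ finite_set J, nbhs y B, B `<=` A &
    forall u v, B u -> agree_on J u v -> B v]].
have cylF : Filter cyl.
  split.
  - by exists set0, setT; split=> //; exact: filterT.
  - move=> A A' [J [B [Jf By BA Bc]]] [J' [B' [Jf' By' BA' Bc']]].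
    exists (J `|` J'), (B `&` B'); split.
    + by rewrite finite_setU.
    + exact: filterI.
    + by apply: setISS.
    + move=> u v [Bu B'u] uv; split.
        by apply: Bc Bu _; apply: agree_onW uv; exact: subsetUl.
      by apply: Bc' B'u _; apply: agree_onW uv; exact: subsetUr.
  - by move=> A A' AA' [J [B [? ? BA ?]]]; exists J, B; split=> //;
      exact: subset_trans AA'.
suff : cvg_to cyl (nbhs y) by apply.
apply/(@cvg_sup _ _ (fun i => Topological.class
  (initial_topology (fun h : (forall i, Y i) => h i))) _ y) => i A; rewrite nbhsE => -[_ [[C oC <-] Cy] CA].
exists [set i], ((fun z : prod_topology Y => z i) @^-1` C); split => //.
- exact: (@proj_continuous {classic I} Y i y C (open_nbhs_nbhs (conj oC Cy))).
- by move=> u v /= Cu <-.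
Qed.

Lemma finite_variant_dense (I : Type) (Y : I -> topologicalType)
    (a y : prod_topology Y) (U : set (prod_topology Y)) : nbhs y U ->
  exists2 z, U z & finite_variant a z.
Proof.
move=> /prod_nbhs_cylinder[J [B [Jf By BU Bc]]]; exists (freeze J a y).
  apply/BU/(Bc y); first exact: nbhs_singleton.
  by move=> i Ji; rewrite freeze_agree.
by exists J => //; exact: freeze_agreeC.
Qed.

(** Each point has a neighborhood, a cylinder over a finite [J], on which [g]
    varies by less than [e / 2] from its value at that point; a finite [K]
    containing [J] then works at all points of that cylinder.  The near-covering
    form of compactness, for the filter of large sets of coordinates, extracts
    one finite set for all points. *)
Lemma continuous_depends_on (R : realType) (I : Type)
    (Y : I -> topologicalType) (g : prod_topology Y -> R) (e : R) :
  compact [set: prod_topology Y] -> continuous g -> 0 < e ->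
  exists2 J, finite_set J & depends_on e J g.
Proof.
move=> /compact_near_coveringP cY gc e0.
pose F := filter_from (@finite_set I) (fun J0 => [set J | J0 `<=` J]).
have FF : Filter F.
  apply: filter_from_filter; first by exists set0.
  move=> J K Jf Kf; exists (J `|` K); first by rewrite finite_setU.
  by move=> L /=; rewrite subUset.
have [] := cY _ F
    (fun J y => forall z, agree_on J y z -> `|g y - g z| <= e) FF.
  move=> y _.
  have /prod_nbhs_cylinder[J [B [Jf By BU Bc]]] :
      nbhs y [set z | `|g y - g z| < e / 2].
    by have /cvgrPdist_lt := gc y; apply; rewrite divr_gt0.
  exists (B, [set K | J `<=` K]); first by split=> //; exists J.
  move=> [u K] /= [Bu JK] z uz.
  have /BU/= uy := Bu.
  have /BU/= zy : B z by apply: Bc Bu _; exact: agree_onW uz.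
  rewrite (splitr e) (le_trans (ler_distD (g y) _ _))// lerD//.
    by rewrite distrC ltW.
  exact: ltW.
move=> J Jf JP; exists J => // y z; exact: (JP J).
Qed.

(** * Category arguments *)

Lemma baire_somewhere_dense (X : topologicalType) (D : nat -> set X) :
  baire_space X -> (forall x, exists n, D n x) ->
  forall U, open U -> U !=set0 ->
  exists n V, [/\ open V, V !=set0, V `<=` U & V `<=` closure (D n)].
Proof.
move=> bX Dall U oU U0; apply: contrapT => nodense.
have [|x [Ux xF]] := bX (fun n => ~` closure (D n `&` U)) _ U U0 oU.
  move=> n; split; first exact/closed_openC/closed_closure.
  move=> O [x Ox] oO; apply: contrapT => OF; apply: nodense.
  have OD : O `<=` closure (D n `&` U).
    by move=> z Oz; apply: contrapT => zD; apply: OF; exists z.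
  exists n, (O `&` U); split.
  - exact: openI.
  - have [w [[_ Uw] Ow]] := OD x Ox O (open_nbhs_nbhs (conj oO Ox)).
    by exists w.
  - by move=> z [].
  - by move=> z [/OD zD _]; apply: closure_subset zD => w [].
have [n Dnx] := Dall x; apply: (xF n) => //.
by apply: subset_closure.
Qed.

(** Induction on the number [n] of coordinates needed beyond [J].  If [J] fails
    on an open [G] because of a point [y] equal to [a] off [K], then [y] and
    its frozen version [freeze J a y] differ only on [K] minus [J]; so a list of
    coordinates that works, together with [J], at a point of [G] has a member in
    [K], which can be dropped once [K] is added to [J]. *)
Lemma finite_support_somewhere (R : realType) (X : topologicalType)
    (I : choiceType) (Y : I -> Type) (f : X * (forall i, Y i) -> R)
    (a : forall i, Y i) (e : R) (n : nat) (J : set I) (V : set X) :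
  finite_set J -> open V -> V !=set0 ->
  V `<=` closure [set x | exists2 s : seq I, (size s <= n)%N &
            depends_on e (J `|` [set` s]) (fun y => f (x, y))] ->
  exists J' V', [/\ finite_set J', open V', V' !=set0, V' `<=` V &
    forall y, finite_variant a y ->
    forall G, open G -> G !=set0 -> G `<=` V' ->
    exists2 x, G x & `|f (x, y) - f (x, freeze J' a y)| <= e].
Proof.
elim: n J V => [|n IHn] J V Jf oV V0 VD.
  exists J, V; split=> // y _ G oG [x Gx] GV.
  have [w [[s]]] := VD x (GV x Gx) G (open_nbhs_nbhs (conj oG Gx)).
  rewrite leqn0 => /nilP -> wJ Gw; exists w => //; apply: wJ => i [|//] Ji.
  by rewrite freeze_agree.
have [good|] := pselect (forall y, finite_variant a y ->
    forall G, open G -> G !=set0 -> G `<=` V ->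
    exists2 x, G x & `|f (x, y) - f (x, freeze J a y)| <= e).
  by exists J, V; split.
move=> /existsNP[y /not_implyP[[K Kf Ky] /existsNP[G]]].
move=> /not_implyP[oG /not_implyP[G0 /not_implyP[GV Gbad]]].
(* [G] is an open set of failure for [J] and [y]; continue inside it with
   [J `|` K]. *)
have [||||J' [V' [J'f oV' V'0 V'G J'P]]] := IHn (J `|` K) G => //.
- by rewrite finite_setU.
- move=> x Gx O /= Ox.
  have [w [[s sn ws] [Ow Gw]]] : [set x | exists2 s : seq I, (size s <= n.+1)%N &
            depends_on e (J `|` [set` s]) (fun y => f (x, y))]
      `&` (O `&` G) !=set0.
    by apply: VD (GV x Gx) _ _; apply: filterI => //; exact: open_nbhs_nbhs.
  exists w; split => //.
  have [[i [si Ki]]|sK] := pselect (exists i, i \in s /\ K i).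
    exists (rem i s); first by rewrite size_rem //; case: (s) sn.
    move=> u v uv; apply: ws => j Jsj; apply: uv.
    case: Jsj => [Jj|/=]; first by left; left.
    rewrite (perm_mem (perm_to_rem si)) inE => /orP[/eqP->|js].
      by left; right.
    by right.
  exfalso; apply: Gbad; exists w => //; apply: ws => i Jsi.
  have [Ji|nJi] := pselect (J i); first by rewrite freeze_agree.
  rewrite freeze_agreeC// Ky// => Ki; apply: sK; exists i; split => //.
  by case: Jsi.
- by exists J', V'; split => //; exact: subset_trans GV.
Qed.

(** A value [f (u, v)] near [(x, y)] is compared with [c] in four steps of size
    [e]: move [v] to a finite variant [z] of [a] by continuity, move [u] within
    an open set [G] by quasi-continuity, choose in [G] a point where freezing [z]
    is harmless, and use the hypothesis on the frozen function there. *)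
Lemma oscillation_of_freeze (R : realType) (X : topologicalType) (I : Type)
    (Y : I -> topologicalType) (f : X * prod_topology Y -> R)
    (a : prod_topology Y) (e : R) (J : set I) (V : set X) :
  (forall y, quasi_continuous (fun x => f (x, y))) ->
  (forall x, continuous (fun y => f (x, y))) ->
  0 < e -> open V ->
  (forall y, finite_variant a y ->
    forall G, open G -> G !=set0 -> G `<=` V ->
    exists2 x, G x & `|f (x, y) - f (x, freeze J a y)| <= e) ->
  forall (c : R) (x : X) (y : prod_topology Y), V x ->
  (\forall p \near (x, y), `|c - f (p.1, freeze J a p.2)| <= e) ->
  \forall p \near (x, y), `|c - f p| <= e *+ 4.
Proof.
move=> fq fc e0 oV VJ c x y Vx [[W O] /= [Wx Oy] WO].
(* [VJ] is available at points of [V] only, and [G] below must stay in [V]. *)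
exists (V `&` W°, O°).
  split => /=; last exact: nbhs_interior.
  by apply: filterI; [exact: open_nbhs_nbhs | exact: nbhs_interior].
move=> [u v] /= [[Vu Wu] Ov].
have [z [Oz zv] az] : exists2 z, (O `&` [set z | `|f (u, v) - f (u, z)| < e]) z &
    finite_variant a z.
  apply: (finite_variant_dense _ _ a v); apply: filterI => //.
  by have /cvgrPdist_lt /(_ _ e0) := fc u v.
(* The new open set need not contain [u]; it only has to meet the dense set of
   points provided by [VJ]. *)
have [||G [oG G0 GVW Gz]] := fq z u (V `&` W) (ball (f (u, z)) e).
- by apply: filterI => //; exact: open_nbhs_nbhs.
- exact: nbhsx_ballx.
have [w Gw wz] := VJ z az G oG G0 (fun t Gt => proj1 (GVW t Gt)).
have /WO/= wc : (W `*` O) (w, z) by split => //; have [] := GVW w Gw.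
have uw : `|f (u, z) - f (w, z)| < e by apply: Gz; exists w.
move: zv wz wc uw => /=; rewrite !ltr_norml !ler_norml => *.
apply/andP; split; lra.
Qed.

(** Comparing with a constant [c] rather than with [f t] makes this set open. *)
Definition small_oscillation {R : realType} {T : topologicalType}
    (f : T -> R) (e : R) : set T :=
  [set t | exists c, \forall p \near t, `|c - f p| <= e].

Lemma namioka_of_small_oscillation (R : realType) (X Y : topologicalType)
    (f : X * Y -> R) :
  baire_space X -> compact [set: Y] ->
  (forall e U, 0 < e -> open U -> U !=set0 ->
    exists2 x, U x & forall y, small_oscillation f e (x, y)) ->
  namioka_property f.
Proof.
move=> bX /compact_near_coveringP cY small.
pose E n := [set x | forall y, small_oscillation f n.+1%:R^-1 (x, y)].
have oE n : open (E n).
  rewrite openE => x Ex.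
  have : \forall u \near x, [set: Y] `<=`
      (fun y => small_oscillation f n.+1%:R^-1 (u, y)).
    apply: cY => y _; have [c /near_join[[W O] [/= Wx Oy] WO]] := Ex y.
    exists (O, W) => // -[v u] /= [Ov Wu]; exists c.
    exact: (WO (u, v)).
  by apply: filterS => u uE y; exact: uE.
exists (\bigcap_n E n); split.
- apply: bX => n; split => // O O0 oO.
  have [x Ox xE] := small n.+1%:R^-1 O (ltac:(by rewrite invr_gt0)) oO O0.
  by exists x.
- by exists E.
- move=> [x y] [/= xE _]; apply/cvgrPdist_le => e e0.
  have e20 : 0 < e / 2 by rewrite divr_gt0.
  have [n _ /(_ n (leqnn n)) /= ne] := near_infty_natSinv_lt (PosNum e20).
  have [c cP] := xE n I y; have cxy := nbhs_singleton cP.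
  apply: filterS cP => p cp; rewrite (splitr e).
  rewrite (le_trans (ler_distD c _ _))// lerD//.
    by rewrite distrC (le_trans cxy)// ltW.
  by rewrite (le_trans cp)// ltW.
Qed.

Theorem theorem4p1 (R : realType) (I : Type) (Y : I -> topologicalType)
  (Ycompact : forall i : I, compact [set: Y i])
  (Yfin : forall I0 : set I, finite_set I0 ->
     kempisty_space R (prod_topology (fun i : I0 => Y (val i)))) :
  kempisty_space R (prod_topology Y).
Proof.
move=> X bX f fq fc.
have cY : compact [set: prod_topology Y].
  have := @tychonoff {classic I} Y (fun i => setT) Ycompact.
  by congr compact; apply/seteqP; split.
apply: namioka_of_small_oscillation => // e U e0 oU U0.
(* If the product is empty there is no base point, but nothing to prove. *)
have [[a]|noY] := pselect (inhabited (prod_topology Y)); last first.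
  by have [x Ux] := U0; exists x => // y; exfalso; apply: noY.
have d0 : 0 < e / 4%:R by rewrite divr_gt0.
have [|n [V [oV V0 VU VD]]] := @baire_somewhere_dense X
  (fun n => [set x | exists2 s : seq {classic I}, (size s <= n)%N &
            depends_on (e / 4%:R) (set0 `|` [set` s]) (fun y => f (x, y))])
  bX _ U oU U0.
  move=> x; have [J /(@finite_seqP {classic I})[s ->] sP] :=
    continuous_depends_on R I Y _ _ cY (fc x) d0.
  by exists (size s), s => //; rewrite set0U.
have [J [W [Jf oW W0 WV WJ]]] := @finite_support_somewhere R X {classic I} Y f
  a _ n set0 V (finite_set0 _) oV V0 VD.
pose ext : prod_topology (fun i : J => Y (val i)) -> prod_topology Y :=
  @extend I Y J a.
have extc : continuous ext.
  apply: continuous_to_prod => i; rewrite /ext /extend.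
  case: pselect => [Ji|_]; last exact: cst_continuous.
  exact: (@proj_continuous {classic J} (fun j : J => Y (val j))
    (exist _ i (mem_set Ji))).
have [||A [dA _ Ac]] := Yfin J Jf X bX (fun p => f (p.1, ext p.2)).
- by move=> z; exact: (fq (ext z)).
- move=> x z.
  exact: (@continuous_comp _ _ _ ext (fun y => f (x, y)) z (extc z)
    (fc x (ext z))).
have [x [Wx Ax]] := dA W W0 oW.
exists x; first exact/VU/WV.
move=> y; exists (f (x, freeze J a y)).
have -> : e = (e / 4%:R) *+ 4 by rewrite -mulr_natr divfK// pnatr_eq0.
apply: oscillation_of_freeze WJ _ _ _ Wx _ => //.
have restrictc : continuous
    (fun y : prod_topology Y => (fun j => y (val j))
       : prod_topology (fun i : J => Y (val i))).
  by apply: continuous_to_prod => j; exact: (@proj_continuous {classic I}).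
have := Ac (x, fun j => y (val j)) (conj Ax Logic.I).
move=> /cvgrPdist_le/(_ _ d0)[[N O] /= [Nx Oy] NO].
exists (N, (fun z j => z (val j)) @^-1` O); first by split=> //; exact: restrictc.
by move=> [u v] /= [Nu Ov]; exact: (NO (u, fun j => v (val j))).
Qed.
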